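(* If $n$ and $a$ are integers with $n=3a-1$ and $a\ge 4$, then $$\beta_b(\overrightarrow{C}(n;1,a)) = \beta_b(\overrightarrow{C}(n;1,-(2a-1))) = \left\lfloor \frac{n}{2}\right\rfloor.$$
   Context: For integers $n\ge 3$ and $b_1,\dots,b_k$, the oriented circulant graph $\overrightarrow{C}(n;b_1,\dots,b_k)$ has vertex set $\{v_0,\dots,v_{n-1}\}$ and arc set $\{v_iv_{i+b_j} : 0\le i\le n-1,\ 1\le j\le k\}$, with subscripts taken modulo $n$ (negative $b_j$ allowed). $d(u,v)$ is the length of a shortest directed path from $u$ to $v$; $e(v)=\max_u d(v,u)$ is the eccentricity; $\mathrm{diam}$ is the maximum eccentricity. An independent broadcast on an oriented graph $\overrightarrow{G}$ is a function $f:V(\overrightarrow{G})\to\{0,\dots,\mathrm{diam}(\overrightarrow{G})\}$ with $f(v)\le e(v)$ for all $v$, and $d(u,v)>f(u)$ for all distinct $u,v$ with $f(u),f(v)>0$. Its cost is $\sigma(f)=\sum_v f(v)$, and $\beta_b(\overrightarrow{G})$ is the maximum cost of an independent broadcast on $\overrightarrow{G}$. *)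

(* Defs.v *)
From mathcomp Require Import all_boot all_order all_algebra.

Set Implicit Arguments.
Unset Strict Implicit.
Unset Printing Implicit Defensive.

Section Broadcast.

Variables (T : finType) (e : rel T).

Definition has_walk (u v : T) (k : nat) : bool :=
  [exists p : k.-tuple T, path e u p && (last u p == v)].

(* A shortest directed path has fewer than #|T| arcs, so #|T| serves as the
   "infinite" distance, returned exactly when v is not reachable from u. *)
Definition dist (u v : T) : nat := find (has_walk u v) (iota 0 #|T|).

Definition ecc (v : T) : nat := \max_(u : T) dist v u.

Definition diam : nat := \max_(v : T) ecc v.

Definition indep_broadcast (f : {ffun T -> 'I_diam.+1}) : bool :=
  [forall v, f v <= ecc v] &&
  [forall u, forall v,
     [&& u != v, 0 < f u & 0 < f v] ==> (f u < dist u v)].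

Definition cost (f : {ffun T -> 'I_diam.+1}) : nat := \sum_(v : T) f v.

(* The zero function is an independent broadcast, so this maximum is always
   attained. *)
Definition beta_b : nat :=
  \max_(f : {ffun T -> 'I_diam.+1} | indep_broadcast f) cost f.

Lemma has_walkP u v k :
  reflect (exists p, [/\ path e u p, last u p = v & size p = k])
          (has_walk u v k).
Proof.
apply: (iffP existsP) => [[p /andP[ep /eqP <-]]|[p [ep <- <-]]].
  by exists p; rewrite size_tuple.
by exists (in_tuple p); rewrite ep eqxx.
Qed.

Lemma dist_min u v p : path e u p -> last u p = v -> dist u v <= size p.
Proof.
move=> ep lp; rewrite leqNgt; apply/negP => ltp.
have ltT : size p < #|T|.
  by apply: leq_trans ltp _; rewrite -[leqRHS](size_iota 0) find_size.
have := before_find 0 ltp; rewrite nth_iota // add0n => /has_walkP[].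
by exists p.
Qed.

Lemma dist_connect u v : (dist u v < #|T|) = connect e u v.
Proof.
rewrite -[X in _ < X](size_iota 0) -has_find; apply/hasP/connectP.
  by case=> k _ /has_walkP[p [ep <- _]]; exists p.
case=> p0 /shortenP[p ep /card_uniqP up _] ->.
exists (size p); last by apply/has_walkP; exists p.
by rewrite mem_iota add0n /= -[(size p).+1]up max_card.
Qed.

Lemma dist_attained u v : connect e u v ->
  exists p, [/\ path e u p, last u p = v & size p = dist u v].
Proof.
rewrite -dist_connect => ltT; apply/has_walkP.
have hasw : has (has_walk u v) (iota 0 #|T|) by rewrite has_find size_iota.
by have := nth_find 0 hasw; rewrite nth_iota.
Qed.

End Broadcast.

Definition circulant (n : nat) (bs : seq int) : rel 'I_n :=
  fun i j => has (fun b : int => j%:Z == (i%:Z + b)%R %[mod n%:Z])%Z bs.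
Arguments circulant n bs : clear implicits.

(* Main.v *)
(** Since 3a = 1 modulo n, multiplication by 3 turns the arcs of step a and 1
    into arcs of step 1 and 3, so that d(v, v + g * a) <= g %/ 3 + g %% 3
    <= g / 2 + 1. Hence, for an independent broadcast f, the intervals
    v, v + a, ..., v + (2 f(v) - 1) * a are pairwise disjoint, which gives
    2 * cost f <= n. The bound is attained, in the coordinate m = 3v mod n, by
    the indicator of the even numbers if n is even, and if n is odd by giving
    weight 1 to the even m <= n - 7 and weight 2 to m = n - 5. *)
Require Import Defs.
From mathcomp Require Import all_boot all_order all_algebra.
From mathcomp Require Import zify.

Set Implicit Arguments.
Unset Strict Implicit.
Unset Printing Implicit Defensive.

(** * Broadcasts and short distances in an arbitrary digraph *)

Section Broadcasts.

Variables (T : finType) (e : rel T).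

Lemma dist_le_ecc u v : dist e u v <= ecc e u.
Proof. exact: (leq_bigmax (F := fun w => dist e u w)). Qed.

Lemma ecc_le_diam v : ecc e v <= diam e.
Proof. exact: (leq_bigmax (F := fun w => ecc e w)). Qed.

(** Lets a broadcast be given with values in [nat]: the bound by the eccentricity already puts them
    within the diameter. *)
Lemma leq_beta_b (F : T -> nat) :
  (forall v, F v <= ecc e v) ->
  (forall u v, u != v -> 0 < F u -> 0 < F v -> F u < dist e u v) ->
  \sum_v F v <= beta_b e.
Proof.
move=> F_ecc F_dist.
pose f : {ffun T -> 'I_(diam e).+1} := [ffun v => inord (F v)].
have fE v : f v = F v :> nat.
  by rewrite ffunE inordK // ltnS (leq_trans (F_ecc v)) ?ecc_le_diam.
have -> : \sum_v F v = cost f by apply: eq_bigr => v _; rewrite fE.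
apply: (leq_bigmax_cond (F := fun f => cost f)).
apply/andP; split; first by apply/forallP => v; rewrite fE.
apply/forallP => u; apply/forallP => v; apply/implyP.
by rewrite !fE => /and3P[]; apply: F_dist.
Qed.

Lemma dist_gt1 u v : u != v -> ~~ e u v -> 1 < dist e u v.
Proof.
move=> uv nev; rewrite ltnNge; apply/negP => le1.
have T1 : 1 < #|T|.
  by rewrite (cardD1 u) inE (cardD1 v) !inE eq_sym uv.
have /dist_attained[p [ep lp sp]] : connect e u v.
  by rewrite -dist_connect (leq_ltn_trans le1).
move: le1 uv nev; rewrite -sp -lp.
by case: p {lp sp} ep => [|x [|]] //=; rewrite ?eqxx ?andbT // => ->.
Qed.

(** As unreachable vertices get distance [#|T|], the size condition ensures that a distance of at
    most 2 comes from an actual walk. *)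
Lemma dist_gt2 u v : 2 < #|T| -> u != v -> ~~ e u v ->
  (forall w, ~~ (e u w && e w v)) -> 2 < dist e u v.
Proof.
move=> T2 uv nev nevv; rewrite ltnNge; apply/negP => le2.
have /dist_attained[p [ep lp sp]] : connect e u v.
  by rewrite -dist_connect (leq_ltn_trans le2).
move: le2 uv nev nevv; rewrite -sp -lp.
case: p {lp sp} ep => [|x [|y [|]]] //=; rewrite ?eqxx ?andbT // => exy.
  by rewrite exy.
by move=> _ _ _ /(_ x); rewrite exy.
Qed.

End Broadcasts.

Lemma sum_even k : \sum_(0 <= m < k.*2) ~~ odd m = k.
Proof.
elim: k => [|k IH]; first by rewrite big_nil.
by rewrite doubleS !big_nat_recr //= IH odd_double addn1 addn0.
Qed.

(** * Arithmetic and distances in the circulant graph *)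

Section Circulant.

Variables (n a : nat) (e : rel 'I_n).
Hypotheses (ha : 4 <= a) (hn : n = 3 * a - 1).
(** The arc relation is abstract so that both circulants of the theorem are instances of it. *)
Hypothesis eE : forall i j : 'I_n,
  e i j = (j == (i + 1) %% n :> nat) || (j == (i + a) %% n :> nat).

Let n_gt0 : 0 < n. Proof. by lia. Qed.

Definition ord_mod (k : nat) : 'I_n := Ordinal (ltn_pmod k n_gt0).

Lemma mod_mul3a k : 3 * a * k = k %[mod n].
Proof.
have -> : 3 * a * k = k * n + k by rewrite hn; nia.
by rewrite modnMDl.
Qed.

Lemma walk_steps (b q : nat) (u : 'I_n) : b = 1 \/ b = a ->
  exists p, [/\ path e u p, last u p = ord_mod (u + q * b) & size p = q].
Proof.
move=> b1a; elim: q u => [|q IH] u.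
  by exists [::]; split=> //; apply: val_inj; rewrite /= addn0 modn_small.
have [p [ep lp sp]] := IH (ord_mod (u + b)).
exists (ord_mod (u + b) :: p); split => /=; last by rewrite sp.
  by rewrite ep andbT eE /=; case: b1a => ->; rewrite eqxx ?orbT.
by rewrite lp; apply: val_inj; rewrite /= modnDml mulSn addnA.
Qed.

Lemma dist_mul_a (u : 'I_n) g :
  dist e u (ord_mod (u + g * a)) <= g %/ 3 + g %% 3.
Proof.
have [p [ep lp sp]] := walk_steps (g %/ 3) u (or_introl erefl).
have [p' [ep' lp' sp']] :=
  walk_steps (g %% 3) (ord_mod (u + g %/ 3 * 1)) (or_intror erefl).
rewrite -sp -sp' -size_cat; apply: dist_min.
  by rewrite cat_path ep lp.
rewrite last_cat lp lp'; apply: val_inj => /=.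
rewrite modnDml {3}(divn_eq g 3) mulnDl addnA muln1.
apply/eqP; rewrite eqn_modDr eqn_modDl -mulnA [_ * (3 * a)]mulnC.
by rewrite mod_mul3a.
Qed.

Lemma exists_mul_a (u v : 'I_n) : exists2 g, g < n & v = ord_mod (u + g * a).
Proof.
(* As 3 is inverse to [a] modulo [n], the multiplier is 3(v - u), with [n - u] standing for -u. *)
exists ((3 * (v + (n - u))) %% n); first by rewrite ltn_mod.
apply: val_inj => /=; rewrite -modnDmr modnMml.
have -> : 3 * (v + (n - u)) * a = 3 * a * (v + (n - u)) by lia.
rewrite mod_mul3a modnDmr.
have -> : u + (v + (n - u)) = v + n by have := ltn_ord u; lia.
by rewrite modnDr modn_small.
Qed.

Lemma ecc_le (u : 'I_n) : ecc e u <= a.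
Proof.
apply/bigmax_leqP => v _; have [g g_lt ->] := exists_mul_a u v.
by apply: leq_trans (dist_mul_a u g) _; lia.
Qed.

Lemma muln_a_inj i j : i < n -> j < n -> i * a = j * a %[mod n] -> i = j.
Proof.
move=> ltin ltjn eq_ij.
have : 3 * a * i = 3 * a * j %[mod n].
  have cE k : 3 * a * k = 3 * (k * a) by lia.
  by rewrite !cE -modnMmr eq_ij modnMmr.
by rewrite !mod_mul3a !modn_small.
Qed.

(** * Upper bound by packing disjoint intervals *)

Section UpperBound.

Variable f : {ffun 'I_n -> 'I_(diam e).+1}.
Hypothesis f_indep : indep_broadcast f.

Let f_le v : f v <= a.
Proof.
by case/andP: f_indep => /forallP/(_ v) le_f _; apply: leq_trans (ecc_le v).
Qed.

(** A common point puts [u] at [v + g * a] with g = j - i <= 2 f(v) - 1, hence d(v, u) <= f(v),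
    against independence. The order of [i] and [j] decides which of the two broadcasts is
    contradicted. *)
Lemma interval_disjoint (u v : 'I_n) i j :
  i <= j -> i < 2 * f u -> j < 2 * f v ->
  u + i * a = v + j * a %[mod n] -> u = v.
Proof.
move=> le_ij lt_i lt_j eq_uv.
have uE : u = ord_mod (v + (j - i) * a).
  apply: val_inj => /=; rewrite -[LHS](modn_small (ltn_ord u)).
  apply/eqP; rewrite -(eqn_modDr (i * a)) eq_uv -addnA -mulnDl.
  by rewrite subnK.
apply/eqP; rewrite eq_sym; apply: contraT => neq_vu.
case/andP: f_indep => _ /forallP/(_ v)/forallP/(_ u)/implyP f_dist.
have := dist_mul_a v (j - i); rewrite -uE.
have : f v < dist e v u by apply: f_dist; rewrite neq_vu /=; lia.
lia.
Qed.

Lemma cost_le : 2 * cost f <= n.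
Proof.
pose P := {v : 'I_n & 'I_(2 * f v)}.
pose h (x : P) : 'I_n := ord_mod (tag x + tagged x * a).
have h_inj : injective h.
  move=> [u i] [v j] /(congr1 val); rewrite /h /= => eq_uv.
  have uv : u = v.
    have [le_ij | /ltnW le_ji] := leqP i j.
      exact: interval_disjoint le_ij _ _ eq_uv.
    exact/esym/(interval_disjoint le_ji _ _ (esym eq_uv)).
  case: v / uv j eq_uv => j /eqP; rewrite eqn_modDl => /eqP eq_ij.
  (* An interval does not overlap itself, since its length 2 f(u) is at most 2a < n. *)
  congr (Tagged _ _); apply: val_inj; apply: muln_a_inj eq_ij.
    by have := ltn_ord i; have := f_le u; lia.
  by have := ltn_ord j; have := f_le u; lia.
have := leq_card h h_inj; rewrite card_ord; apply: leq_trans.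
rewrite card_tagged sumnE big_map big_enum big_distrr /=.
by apply: leq_sum => v _; rewrite card_ord.
Qed.

End UpperBound.

(** * Lower bound by an explicit broadcast *)

Definition optimal_weight (m : nat) : nat :=
  if odd n && (n < m + 7) then (m + 5 == n).*2 else ~~ odd m.

Lemma sum_optimal_weight : \sum_(m < n) optimal_weight m = n %/ 2.
Proof.
rewrite -(big_mkord xpredT optimal_weight).
case: (boolP (odd n)) => on.
  (* For odd [n], the even numbers n - 3 and n - 1 have arcs to 0 and get no weight. The last five
     terms, m = 2k, ..., 2k + 4, are split off; only m = 2k = n - 5 contributes, namely 2. *)
  have [k nE] : exists k, n = k.*2.+1 + 4 by exists (n./2 - 2); lia.
  have w_lt : \sum_(0 <= m < k.*2) optimal_weight m = k.
    rewrite -[RHS]sum_even; apply: eq_big_nat => m m_lt.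
    by rewrite /optimal_weight on; case: ltnP => //= ?; lia.
  rewrite [X in index_iota _ X]nE !addnS addn0 !big_nat_recr //= w_lt.
  rewrite /optimal_weight on /=; have -> : n %/ 2 = k + 2 by lia.
  by rewrite !ifT; lia.
rewrite -[n in index_iota _ n]even_halfK // divn2 -[RHS]sum_even.
by apply: eq_bigr => m _; rewrite /optimal_weight (negbTE on).
Qed.

Lemma optimal_weight_gt0 m : 0 < optimal_weight m ->
  [/\ ~~ odd m, odd n -> m + 5 <= n &
      optimal_weight m = (odd n && (m + 5 == n)).+1].
Proof.
rewrite /optimal_weight; case: ifP => [/andP[on _]|].
  by rewrite double_gt0 lt0b on => /eqP mE; rewrite mE eqxx; split=> //; lia.
by move=> small; rewrite lt0b => m_even; split=> //; lia.
Qed.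

Definition coord (v : 'I_n) : 'I_n := ord_mod (3 * v).

Lemma ord_mod_mulaK : cancel (fun m : 'I_n => ord_mod (a * m)) coord.
Proof.
by move=> m; apply: val_inj; rewrite /= modnMmr mulnA mod_mul3a modn_small.
Qed.

Lemma coordK : cancel coord (fun m : 'I_n => ord_mod (a * m)).
Proof.
move=> v; apply: val_inj; rewrite /= modnMmr mulnA (mulnC a) mod_mul3a.
by rewrite modn_small.
Qed.

Lemma coord_arc u v : e u v ->
  coord v = (coord u + 3) %% n :> nat \/ coord v = (coord u + 1) %% n :> nat.
Proof.
rewrite eE => /orP[] /eqP vE; [left | right].
  by rewrite /= vE modnMmr mulnDr modnDml.
by rewrite /= vE modnMmr mulnDr modnDml -modnDmr -[3 * a]muln1 mod_mul3a modnDmr.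
Qed.

Lemma modn_addE m k : m < n -> k <= n ->
  (m + k) %% n = if m + k < n then m + k else m + k - n.
Proof.
move=> m_lt k_le; case: ltnP => mk; first exact: modn_small.
by rewrite -{1}(subnK mk) modnDr modn_small //; lia.
Qed.

(** Arcs add 1 or 3 to the coordinate and so change parity, except when wrapping around an odd [n];
    there, no arc from a coordinate of at most n - 5 wraps. From n - 5, two arcs lead to n - 3, n -
    1 or 1, all of weight 0. *)
Lemma optimal_weight_dist u v : u != v ->
  0 < optimal_weight (coord u) -> 0 < optimal_weight (coord v) ->
  optimal_weight (coord u) < dist e u v.
Proof.
move=> uv /optimal_weight_gt0[cu cu_le ->] /optimal_weight_gt0[cv cv_le _].
(* Removing the modulus leaves linear equations that [lia] can decide. *)
have step x y : e x y -> [\/ coord y = coord x + 3 :> nat,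
    coord y + n = coord x + 3 :> nat, coord y = coord x + 1 :> nat |
    coord y + n = coord x + 1 :> nat].
  have n3 : 3 <= n by lia.
  case/coord_arc; rewrite modn_addE ?(ltn_ord, n_gt0, n3) //; case: ltnP => ? ?.
  - by constructor 1.
  - by constructor 2; lia.
  - by constructor 3.
  - by constructor 4; lia.
have lu := ltn_ord (coord u); have lv := ltn_ord (coord v).
have nev : ~~ e u v by apply/negP => /step[]; lia.
case: andP => [[on /eqP cuE]|_] /=; last exact: dist_gt1.
have neq_c : coord u != coord v :> nat by rewrite val_eqE (can_eq coordK).
apply: dist_gt2 => //; first by rewrite card_ord; lia.
move=> w; have lw := ltn_ord (coord w).
by apply/negP => /andP[/step[] wE /step[]]; lia.
Qed.

(** Since n >= 11, coordinates 0 and 2 both have positive weight; one of them differs from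
    [coord v], and its vertex is farther from [v] than the weight of [v]. *)
Lemma optimal_weight_ecc v : optimal_weight (coord v) <= ecc e v.
Proof.
case: (posnP (optimal_weight (coord v))) => [-> // | v_gt0].
have act (m : 'I_n) : 0 < optimal_weight m -> coord v != m ->
    optimal_weight (coord v) <= ecc e v.
  move=> m_gt0 vm; apply: leq_trans (dist_le_ecc e v (ord_mod (a * m))).
  apply/ltnW/optimal_weight_dist; rewrite ?ord_mod_mulaK //.
  by apply: contraNneq vm => ->; rewrite ord_mod_mulaK.
have n2 : 2 < n by lia.
have w_gt0 m : ~~ odd m -> m <= 2 -> 0 < optimal_weight m.
  by move=> m_even m_le; rewrite /optimal_weight ifF ?m_even //; lia.
have [v0 | v_neq0] := eqVneq (val (coord v)) 0.
  by apply: (act (Ordinal n2)); [exact: w_gt0 | rewrite -val_eqE v0].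
by apply: (act (Ordinal n_gt0)); [exact: w_gt0 | rewrite -val_eqE].
Qed.

Lemma beta_b_circulant : beta_b e = n %/ 2.
Proof.
apply/eqP; rewrite eqn_leq; apply/andP; split.
  apply/bigmax_leqP => f /cost_le cost_f.
  by rewrite leq_divRL // mulnC.
rewrite -sum_optimal_weight (reindex coord) /=; last first.
  by apply: onW_bij; exists (fun m : 'I_n => ord_mod (a * m));
    [exact: coordK | exact: ord_mod_mulaK].
exact: leq_beta_b optimal_weight_ecc optimal_weight_dist.
Qed.

End Circulant.

(** * Reduction of both circulants to steps 1 and a *)

Lemma circulant_arc_nat n (i j : 'I_n) (b : int) (k : nat) :
  (b = k%:Z %[mod n%:Z])%Z ->
  (j%:Z == (i%:Z + b)%R %[mod n%:Z])%Z = (j == (i + k) %% n :> nat).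
Proof.
move=> bk; rewrite -modzDmr bk modzDmr -PoszD !modz_nat.
by rewrite (modn_small (ltn_ord j)).
Qed.

Theorem theorem4 (n a : nat) (ha : 4 <= a) (hn : n = 3 * a - 1) :
  beta_b (circulant n [:: 1; a%:Z]%R) =
    beta_b (circulant n [:: 1; - (2 * a%:Z - 1)]%R) /\
  beta_b (circulant n [:: 1; - (2 * a%:Z - 1)]%R) = n %/ 2.
Proof.
have beta_eq (b : int) : (b = a%:Z %[mod n%:Z])%Z ->
    beta_b (circulant n [:: 1; b]%R) = n %/ 2.
  move=> ba; apply: (beta_b_circulant ha hn) => i j.
  by rewrite /circulant /= orbF (circulant_arc_nat _ _ (erefl (1 %% n)%Z))
    (circulant_arc_nat _ _ ba).
rewrite !beta_eq //.
(* As n = 3a - 1, the negative step is congruent to [a], so both graphs have the same arcs. *)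
have -> : (- (2 * a%:Z - 1) = - n%:Z + a%:Z)%R by lia.
by rewrite -GRing.mulN1r modzMDl.
Qed.
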